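(* Let $f,f^\nu:\mathbb{R}^m\times\mathbb{R}^n\to\overline{\mathbb{R}}$ (with $\nu$ fixed) be Rockafellians (for functions $\phi,\phi^\nu:\mathbb{R}^n\to\overline{\mathbb{R}}$, respectively). Suppose that $\operatorname{epi} f$ and $\operatorname{epi} f^\nu$ are nonempty, $\rho\in[0,\infty)$, and $y,y^\nu\in\mathbb{R}^m$. Suppose $\hat\rho\in[\rho,\infty)$ is such that - for every $x\in\mathbb{R}^n$ with $\|x\|_2\le\rho$ and $l(x,y)\le\rho$ there exists $\hat u\in\mathbb{R}^m$ with $\|\hat u\|_2\le\hat\rho$ and $f_y(\hat u,x)\le\max\{-\rho,\,l(x,y)\}$; and - for every $x\in\mathbb{R}^n$ with $\|x\|_2\le\rho$ and $l^\nu(x,y^\nu)\le\rho$ there exists $\hat u^\nu\in\mathbb{R}^m$ with $\|\hat u^\nu\|_2\le\hat\rho$ and $f^\nu_{y^\nu}(\hat u^\nu,x)\le\max\{-\rho,\,l^\nu(x,y^\nu)\}$. Then, using the norms $(u,x,\alpha)\mapsto\max\{\|u\|_2,\|x\|_2,|\alpha|\}$ on $\mathbb{R}^m\times\mathbb{R}^n\times\mathbb{R}$ and $(x,\alpha)\mapsto\max\{\|x\|_2,|\alpha|\}$ on $\mathbb{R}^n\times\mathbb{R}$, and with $\rho'\ge(1+\max\{\|y\|_2,\|y^\nu\|_2\})\hat\rho$, one has $$\hat d_\rho\big(\operatorname{epi} l(\cdot,y),\operatorname{epi} l^\nu(\cdot,y^\nu)\big)\le\big(1+\max\{\|y\|_2,\|y^\nu\|_2\}\big)\,\hat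 d_{\rho'}(\operatorname{epi} f,\operatorname{epi} f^\nu)+\hat\rho\,\|y-y^\nu\|_2.$$
   Context: $\overline{\mathbb{R}}=[-\infty,\infty]$. A function $f:\mathbb{R}^m\times\mathbb{R}^n\to\overline{\mathbb{R}}$ is a Rockafellian for $g:\mathbb{R}^n\to\overline{\mathbb{R}}$ when $f(0,x)=g(x)$ for all $x$. For $y\in\mathbb{R}^m$: $f_y(u,x)=f(u,x)-\langle y,u\rangle$, $f^\nu_y(u,x)=f^\nu(u,x)-\langle y,u\rangle$. Lagrangians: $l(x,y)=\inf_{u\in\mathbb{R}^m}f_y(u,x)$ and $l^\nu(x,y)=\inf_{u\in\mathbb{R}^m}f^\nu_y(u,x)$. The epigraph of $g:\mathbb{R}^d\to\overline{\mathbb{R}}$ is $\operatorname{epi} g=\{(x,\alpha)\in\mathbb{R}^d\times\mathbb{R}\mid g(x)\le\alpha\}$. Truncated Hausdorff distance: given a norm on the ambient space, $\mathbb{B}(\rho)=\{x\mid\|x\|\le\rho\}$; the excess is $\operatorname{exs}(C;D)=\sup_{x\in C}\inf_{y\in D}\|x-y\|$ if $C,D$ are nonempty, $\operatorname{exs}(C;\emptyset)=\infty$ if $C\ne\emptyset$, and $\operatorname{exs}(\emptyset;D)=0$ for every $D$; and $\hat d_\rho(C,D)=\max\{\operatorname{exs}(C\cap\mathbb{B}(\rho);D),\ \operatorname{exs}(D\cap\mathbb{B}(\rho);C)\}$ for $\rho\ge0$. *)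

(* Defs.v *)
From HB Require Import structures.
From mathcomp Require Export all_boot all_order all_algebra.
From mathcomp Require Export all_classical all_reals all_analysis.

Set Implicit Arguments.
Unset Strict Implicit.
Unset Printing Implicit Defensive.

Import Order.TTheory GRing.Theory Num.Theory.

Local Open Scope classical_set_scope.
Local Open Scope ring_scope.

Section Euclidean.
Context {R : realType}.

Definition inner {k : nat} (y u : 'rV[R]_k) : R := \sum_(i < k) y 0 i * u 0 i.

(* The canonical norm `|_| of 'rV[R]_k is the sup norm, hence this one. *)
Definition norm2 {k : nat} (u : 'rV[R]_k) : R :=
  Num.sqrt (\sum_(i < k) u 0 i ^+ 2).

Definition norm_xa {n : nat} (p : 'rV[R]_n * R) : R :=
  Num.max (norm2 p.1) `|p.2|.

Definition norm_uxa {m n : nat} (p : 'rV[R]_m * 'rV[R]_n * R) : R :=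
  Num.max (norm2 p.1.1) (Num.max (norm2 p.1.2) `|p.2|).

End Euclidean.

Section Epigraph.
Context {R : realType}.

Definition epi {T : Type} (g : T -> \bar R) : set (T * R) :=
  [set p | (g p.1 <= (p.2)%:E)%E].

End Epigraph.

(* The set distance is taken with respect to an explicit function [nrm], since
   the norms of interest are not the canonical ones of their carrier types. *)
Section TruncatedHausdorff.
Context {R : realType} {V : zmodType}.
Implicit Types (nrm : V -> R) (C D : set V).

Definition nball nrm (rho : R) : set V := [set v | nrm v <= rho].

(* The first case is needed because [ereal_sup set0] is -oo. *)
Definition excess nrm C D : \bar R :=
  if `[< C = set0 >] then 0%E
  else if `[< D = set0 >] then +oo%E
  else ereal_sup [set ereal_inf [set (nrm (a - b))%:E | b in D] | a in C].

Definition hausdorff_trunc nrm (rho : R) C D : \bar R :=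
  maxe (excess nrm (C `&` nball nrm rho) D)
       (excess nrm (D `&` nball nrm rho) C).

End TruncatedHausdorff.

Section Rockafellian.
Context {R : realType} {m n : nat}.
Implicit Types (f : 'rV[R]_m * 'rV[R]_n -> \bar R) (g : 'rV[R]_n -> \bar R).

Definition rockafellian f g : Prop := forall x, f (0, x) = g x.

Definition tilt f (y : 'rV[R]_m) : 'rV[R]_m * 'rV[R]_n -> \bar R :=
  fun p => (f p - (inner y p.1)%:E)%E.

Definition lagrangian f (x : 'rV[R]_n) (y : 'rV[R]_m) : \bar R :=
  ereal_inf [set tilt f y (u, x) | u in [set: 'rV[R]_m]].

End Rockafellian.

(* Main.v *)
(* If (x, alpha) lies in epi l(., y) and in the rho-ball, a near-minimizer u turns it into
   the point (u, x, alpha + <y, u>) of epi f, which lies in the rho'-ball. A nearby point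
   (u', x', beta') of epi f^nu gives (x', beta' - <ynu, u'>) in epi l^nu(., ynu), and
   <ynu, u'> - <y, u> = <ynu, u' - u> + <ynu - y, u> is controlled by Cauchy-Schwarz. *)
Require Import Defs.
From mathcomp Require Import ring lra.

Set Implicit Arguments.
Unset Strict Implicit.
Unset Printing Implicit Defensive.

Import Order.TTheory GRing.Theory Num.Theory.

Local Open Scope classical_set_scope.
Local Open Scope ring_scope.

Section Euclidean.
Context {R : realType}.

Lemma norm2_ge0 k (u : 'rV[R]_k) : 0 <= norm2 u.
Proof. exact: sqrtr_ge0. Qed.

Lemma norm2B k (u v : 'rV[R]_k) : norm2 (u - v) = norm2 (v - u).
Proof.
by rewrite /norm2; congr Num.sqrt; apply: eq_bigr => i _; rewrite !mxE -sqrrN opprB.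
Qed.

Lemma innerBl k (y z u : 'rV[R]_k) : inner (y - z) u = inner y u - inner z u.
Proof.
by rewrite /inner -sumrB; apply: eq_bigr => i _; rewrite !mxE mulrBl.
Qed.

Lemma innerBr k (y u v : 'rV[R]_k) : inner y (u - v) = inner y u - inner y v.
Proof.
by rewrite /inner -sumrB; apply: eq_bigr => i _; rewrite !mxE mulrBr.
Qed.

Lemma Cauchy_Schwarz k (y u : 'rV[R]_k) : `|inner y u| <= norm2 y * norm2 u.
Proof.
have sq_ge0 (w : 'rV[R]_k) : 0 <= \sum_(i < k) w 0 i ^+ 2.
  by apply: sumr_ge0 => i _; exact: sqr_ge0.
rewrite /norm2 -sqrtrM// -sqrtr_sqr ler_wsqrtr//.
(* Lagrange's identity *)
have : 0 <= \sum_(i < k) \sum_(j < k) (y 0 i * u 0 j - y 0 j * u 0 i) ^+ 2.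
  by apply: sumr_ge0 => i _; apply: sumr_ge0 => j _; exact: sqr_ge0.
suff -> : \sum_(i < k) \sum_(j < k) (y 0 i * u 0 j - y 0 j * u 0 i) ^+ 2 =
    ((\sum_(i < k) y 0 i ^+ 2) * (\sum_(i < k) u 0 i ^+ 2) - inner y u ^+ 2) *+ 2.
  by rewrite pmulrn_lge0// subr_ge0.
(* Swapping the factors in one of the two copies of the product makes the identity hold for each
   pair [(i, j)], not only after summation. *)
rewrite mulrnBl mulr2n {2}[_ * \sum_(i < k) u 0 i ^+ 2]mulrC expr2 /inner !big_distrlr/=.
rewrite -big_split -sumrMnl -sumrB; apply: eq_bigr => i _ /=.
rewrite -big_split -sumrMnl -sumrB; apply: eq_bigr => j _ /=.
by ring.
Qed.

End Euclidean.

Section Excess.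
Context {R : realType} {V : zmodType}.
Implicit Types (nrm : V -> R) (C D : set V).
Local Open Scope ereal_scope.

Lemma excess_ge0 nrm C D : (forall v, (0 <= nrm v)%R) -> 0 <= excess nrm C D.
Proof.
move=> nrm_ge0; rewrite /excess; case: asboolP => // /eqP/set0P[a Ca].
case: asboolP => // _; apply: (@le_trans _ _ (ereal_inf [set (nrm (a - b))%:E | b in D])).
  by apply: le_ereal_inf_tmp => _ [b _ <-]; rewrite lee_fin.
by apply: ereal_sup_ubound; exists a.
Qed.

(** The infimum over [D] need not be attained, so a point of [D] is extracted from a strict bound
    only. *)
Lemma excess_near nrm C D a (e : R) : C a -> D !=set0 ->
  excess nrm C D < e%:E -> exists2 b, D b & (nrm (a - b) < e)%R.
Proof.
move=> Ca D0; rewrite /excess asboolF; last by apply/eqP/set0P; exists a.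
rewrite asboolF; last exact/eqP/set0P.
set S := [set _ | _ in C] => supS.
have : ereal_inf [set (nrm (a - b))%:E | b in D] < e%:E.
  by apply: le_lt_trans supS; apply: ereal_sup_ubound; exists a.
by move=> /ereal_inf_lt[_ [b Db <-]]; rewrite lte_fin; exists b.
Qed.

(** [0 <= e] settles the case of empty [C]; otherwise the witness attached to a point of [C] shows
    that [D] is nonempty, which excludes the value [+oo]. *)
Lemma excess_le nrm C D (e : R) : (0 <= e)%R ->
  (forall a, C a -> exists2 b, D b & (nrm (a - b) <= e)%R) ->
  excess nrm C D <= e%:E.
Proof.
move=> e0 CD; rewrite /excess; case: asboolP => [_|/eqP/set0P[a0 /CD[b0 Db0 _]]].
  by rewrite lee_fin.
rewrite asboolF; last by apply/eqP/set0P; exists b0.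
apply: ge_ereal_sup => _ [a /CD[b Db ab] <-].
apply: (@le_trans _ _ (nrm (a - b))%:E); last by rewrite lee_fin.
by apply: ereal_inf_lbound; exists b.
Qed.

End Excess.

Section Lagrangian.
Context {R : realType} {m n : nat}.
Implicit Types f : 'rV[R]_m * 'rV[R]_n -> \bar R.

(** One of the two excesses in the distance. The constant [c] dominates both [1 + norm2 y], which
    governs the size of the lifted point, and [1 + norm2 ynu], which governs the error, so the lemma
    also applies with the two functions exchanged. *)
Lemma lagrangian_excess_le f fnu (y ynu : 'rV[R]_m) (rho rhohat rho' c : R) :
  epi fnu !=set0 -> 0 <= rho -> rho <= rhohat ->
  1 + norm2 y <= c -> 1 + norm2 ynu <= c -> c * rhohat <= rho' ->
  (forall x : 'rV[R]_n, norm2 x <= rho -> (lagrangian f x y <= rho%:E)%E ->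
    exists uhat : 'rV[R]_m, norm2 uhat <= rhohat /\
      (tilt f y (uhat, x) <= maxe (- rho)%:E (lagrangian f x y))%E) ->
  (excess norm_xa (epi (fun x => lagrangian f x y) `&` nball norm_xa rho)
     (epi (fun x => lagrangian fnu x ynu))
   <= c%:E * excess norm_uxa (epi f `&` nball norm_uxa rho') (epi fnu)
      + (rhohat * norm2 (y - ynu))%:E)%E.
Proof.
move=> fnu0 rho0 rhoh yc ync cr near_min.
have c0 : 0 < c by apply: lt_le_trans yc; rewrite ltr_pwDl ?norm2_ge0.
have c1 : 1 <= c by apply: le_trans yc; rewrite lerDl norm2_ge0.
have rhohat0 : 0 <= rhohat by exact: le_trans rhoh.
have : (0 <= excess norm_uxa (epi f `&` nball norm_uxa rho') (epi fnu))%E.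
  by apply: excess_ge0 => p; rewrite /norm_uxa le_max norm2_ge0.
(* Nonnegativity rules out [-oo]; for [+oo] the right-hand side is [+oo] because [c] is positive. *)
case E : (excess norm_uxa _ _) => [eta| |] // eta0; last first.
  by rewrite gt0_muley ?lte_fin// addye// leey.
rewrite lee_fin in eta0.
apply/lee_addgt0Pr => eps eps0.
rewrite -EFinM -!EFinD.
have eps'0 : 0 < eps / c by rewrite divr_gt0.
(* The slack makes [d] exceed the excess strictly, as [excess_near] requires; multiplied by [c] it
   becomes exactly [eps]. *)
set d := eta + eps / c.
have -> : c * eta + rhohat * norm2 (y - ynu) + eps = c * d + rhohat * norm2 (y - ynu).
  by rewrite /d mulrDr mulrCA divff ?mulr1 ?gt_eqF//; ring.
have d0 : 0 <= d by rewrite addr_ge0// ltW.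
apply: excess_le; first by rewrite addr_ge0 ?mulr_ge0 ?norm2_ge0// ltW.
move=> [x alpha] [/= lx]; rewrite /nball /norm_xa /= ge_max => /andP[xrho arho].
have /andP[arho1 arho2] : - rho <= alpha <= rho by rewrite -ler_norml.
have lrho : (lagrangian f x y <= rho%:E)%E by apply: le_trans lx _; rewrite lee_fin.
have [u [urho fu]] := near_min x xrho lrho.
(* Both terms of the maximum are at most [alpha]: [- rho] by the ball constraint, the Lagrangian by
   membership in the epigraph. *)
have {}fu : (f (u, x) <= (alpha + inner y u)%:E)%E.
  rewrite EFinD -leeBlDr//; apply: le_trans fu _.
  by rewrite ge_max lee_fin arho1.
have yu := Cauchy_Schwarz y u.
have yu' : norm2 y * norm2 u <= norm2 y * rhohat by rewrite ler_wpM2l ?norm2_ge0.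
have ycr : (1 + norm2 y) * rhohat <= c * rhohat by rewrite ler_wpM2r.
have ccr : rhohat <= c * rhohat by rewrite ler_peMl.
(* The last coordinate is at most [rho + norm2 y * rhohat], hence at most [(1 + norm2 y) * rhohat];
   this is where the lower bound on [rho'] comes from. *)
have Cu : (epi f `&` nball norm_uxa rho') (u, x, alpha + inner y u).
  split => //; rewrite /nball /norm_uxa /= !ge_max; apply/and3P; split; [lra|lra|].
  by apply: le_trans (ler_normD _ _) _; lra.
have Ed : (excess norm_uxa (epi f `&` nball norm_uxa rho') (epi fnu) < d%:E)%E.
  by rewrite E lte_fin ltrDl.
have [[[u' x'] beta] /= fnub] := excess_near Cu fnu0 Ed; rewrite /norm_uxa /= !gt_max => /and3P[uu xx bb].
exists (x', beta - inner ynu u').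
  apply: (@le_trans _ _ (tilt fnu ynu (u', x'))).
    by apply: ereal_inf_lbound; exists u'.
  by rewrite /tilt EFinB leeD2r.
have K0 : 0 <= rhohat * norm2 (y - ynu) by rewrite mulr_ge0 ?norm2_ge0.
have cd : d <= c * d by rewrite ler_peMl.
rewrite /= ge_max; apply/andP; split; first lra.
(* [y - ynu] is paired with [u], whose norm is at most [rhohat], and not with [u']. The first two
   terms contribute at most [(1 + norm2 ynu) * d], the third at most [rhohat * norm2 (y - ynu)]. *)
have -> : alpha - (beta - inner ynu u') =
    (alpha + inner y u - beta) - inner ynu (u - u') - inner (y - ynu) u.
  by rewrite innerBl innerBr; ring.
have h1 := Cauchy_Schwarz ynu (u - u').
have h2 := Cauchy_Schwarz (y - ynu) u.
have h3 : norm2 ynu * norm2 (u - u') <= norm2 ynu * d.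
  by rewrite ler_wpM2l ?norm2_ge0// ltW.
have h4 : norm2 (y - ynu) * norm2 u <= norm2 (y - ynu) * rhohat.
  by rewrite ler_wpM2l ?norm2_ge0.
have h5 : (1 + norm2 ynu) * d <= c * d by rewrite ler_wpM2r.
have h6 := ler_normB (alpha + inner y u - beta) (inner ynu (u - u')).
by apply: le_trans (ler_normB _ _) _; lra.
Qed.

End Lagrangian.

Theorem theorem4p2 (R : realType) (m n : nat)
  (f fnu : 'rV[R]_m * 'rV[R]_n -> \bar R) (phi phinu : 'rV[R]_n -> \bar R)
  (f_rock : rockafellian f phi) (fnu_rock : rockafellian fnu phinu)
  (epif_neq0 : epi f !=set0) (epifnu_neq0 : epi fnu !=set0)
  (rho : R) (rho_ge0 : 0 <= rho) (y ynu : 'rV[R]_m)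
  (rhohat : R) (rho_le_rhohat : rho <= rhohat)
  (f_near_min : forall x : 'rV[R]_n,
    norm2 x <= rho -> (lagrangian f x y <= rho%:E)%E ->
    exists uhat : 'rV[R]_m, norm2 uhat <= rhohat /\
      (tilt f y (uhat, x) <= maxe (- rho)%:E (lagrangian f x y))%E)
  (fnu_near_min : forall x : 'rV[R]_n,
    norm2 x <= rho -> (lagrangian fnu x ynu <= rho%:E)%E ->
    exists uhat : 'rV[R]_m, norm2 uhat <= rhohat /\
      (tilt fnu ynu (uhat, x) <= maxe (- rho)%:E (lagrangian fnu x ynu))%E)
  (rho' : R)
  (rho'_ge : (1 + Num.max (norm2 y) (norm2 ynu)) * rhohat <= rho') :
  (hausdorff_trunc norm_xa rho
     (epi (fun x => lagrangian f x y)) (epi (fun x => lagrangian fnu x ynu))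
   <= (1 + Num.max (norm2 y) (norm2 ynu))%:E
        * hausdorff_trunc norm_uxa rho' (epi f) (epi fnu)
      + (rhohat * norm2 (y - ynu))%:E)%E.
Proof.
rewrite /hausdorff_trunc.
set c := 1 + _ in rho'_ge *.
have yc : 1 + norm2 y <= c by rewrite lerD2l le_max lexx.
have ync : 1 + norm2 ynu <= c by rewrite lerD2l le_max lexx orbT.
have c0 : (0 <= c%:E)%E.
  by rewrite lee_fin; apply: le_trans yc; rewrite addr_ge0 ?norm2_ge0.
rewrite ge_max; apply/andP; split.
  apply: le_trans (lagrangian_excess_le epifnu_neq0 rho_ge0 rho_le_rhohat yc ync
    rho'_ge f_near_min) _.
  by rewrite leeD2r// lee_wpmul2l// le_max lexx.
(* The other excess is the same estimate with the roles of [f, y] and [fnu, ynu] exchanged. *)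
rewrite norm2B.
apply: le_trans (lagrangian_excess_le epif_neq0 rho_ge0 rho_le_rhohat ync yc
  rho'_ge fnu_near_min) _.
by rewrite leeD2r// lee_wpmul2l// le_max lexx orbT.
Qed.
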